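(* Suppose Assumptions A1–A3 and the homoscedastic part of Assumption A4 hold. Let there exist a valid coplanar instrument $\mathbf z_0\in\mathcal W(\mathbf x,\mathbf y)$ such that \[ \mathbb E(\mathbf u\mid\mathbf z_0)=\mathbf 0\quad\text{and}\quad \mathbb E(\mathbf e\mathbf e'\mid\mathbf z_0)=\sigma^2\mathbf I_n, \] where $\mathbf e$ is the first-stage residual. Let $\mathbf s(\delta)=\mathbf x+k\delta\mathbf r$, $\delta\in(0,\bar\delta)$, parameterize the class of candidate synthetic instruments, and let $\delta_0\in(0,\bar\delta)$ be such that $\mathbf s(\delta_0)=\mathbf z_0$. Let $\mathbf M(\delta)$ denote the DT moment vector. Then $\mathbf M(\delta_0)=\mathbf 0$. If $\mathbf M(\delta)$ is continuously differentiable in $\delta$ on $(0,\bar\delta)$ and its derivative at $\delta_0$, \[ J_{\mathbf M}(\delta_0):=\frac{\partial\mathbf M(\delta)}{\partial\delta}\Big|_{\delta=\delta_0}, \] is nonzero, then there exists a neighborhood $\mathcal N$ of $\delta_0$ such that for $\delta\in\mathcal N$: $\mathbf M(\delta)=\mathbf 0\iff\delta=\delta_0$. Hence $\delta_0$ is locally identified by the DT condition, and the synthetic instrument $\mathbf s^\star:=\mathbf s(\delta_0)=\mathbf z_0$ is the unique coplanar instrument in $\mathcal W(\mathbf x,\mathbf y)$ satisfying $\mathbb E(\mathbf u\mid\mathbf s^\star)=\mathbf 0$.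
   Context: Setting: all vectors are $n\times1$ random vectors (elements of a separable Hilbert space $\mathcal H$, e.g. $\mathbb R^n$ with the dot product). The structural model is $\mathbf y=\beta\mathbf x+\mathbf u$, where $\mathbf y$ is the outcome, $\mathbf x$ the endogenous regressor with $\operatorname{cov}(\mathbf x,\mathbf u)\neq0$, $\mathbf u$ the unobserved structural error and $\beta$ a scalar (exogenous controls have been partialled out by orthogonal projection). $\mathcal W(\mathbf x,\mathbf y)=\operatorname{span}\{\mathbf x,\mathbf y\}$. $\mathbf P_x=\mathbf x(\mathbf x'\mathbf x)^{-1}\mathbf x'$ and $\mathbf r=(\mathbf I-\mathbf P_x)\mathbf y$. $k:=-\operatorname{sign}(\operatorname{cov}(\mathbf x,\mathbf u))\in\{-1,+1\}$. For an instrument $\mathbf s$, the first-stage regression is $\mathbf x=\gamma\mathbf s+\mathbf e$ with $\gamma=\operatorname{cov}(\mathbf x,\mathbf s)/\operatorname{var}(\mathbf s)$; write $\mathbf e(\delta)=\mathbf x-\gamma(\delta)\mathbf s(\delta)$ for $\mathbf s=\mathbf s(\delta)$. The DT moment vector is $\mathbf M(\delta)=\mathbb E[(\mathbf e(\delta)^{\circ2}-\sigma^2\mathbf 1_n)\odot\mathbf z_0]$, where $\circ2$ is the entrywise square, $\odot$ the entrywise product and $\mathbf 1_n$ the vector of ones. Assumption A1 (Coplanarity): $\mathbf x,\mathbf r,\mathbf s$ belong to $\mathcal W(\mathbf x,\mathbf y)$; $\mathbb E[\mathbf r'\mathbf x]=0$; the observations $\mathbf Z_i$ of $(\mathbf y,\mathbf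 x,\mathbf r)$ are i.i.d. (or stationary and ergodic). Assumption A2 (Synthetic instrument): $\mathbf s=\mathbf x+k\delta\mathbf r$ with $\delta\in(0,\bar\delta)$, where $\bar\delta$ is a finite bound chosen so that $\operatorname{corr}(\mathbf s,\mathbf x)\ge c>0$; $\mathbf s$ affects $\mathbf y$ only through its $\mathbf x$-component, not through $\mathbf r$. Assumption A3 (Full rank): $\mathbb E[\mathbf x'\mathbf y]$ and $\mathbb E[\mathbf x'\mathbf x]$ exist and $\mathbb E[x^2]>0$. Assumption A4, homoscedastic part: the first-stage errors $e_i$ are independent across $i$ and $\mathbb E(e_i^2\mid\mathbf z_0)=\sigma^2$ for all $i$. *)

(* Defs.v *)
From HB Require Import structures.
From mathcomp Require Import all_boot all_order all_algebra.
From mathcomp Require Import all_classical all_reals all_analysis.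
Set Implicit Arguments. Unset Strict Implicit. Unset Printing Implicit Defensive.
Import Order.TTheory GRing.Theory Num.Theory.
Import numFieldNormedType.Exports.
Local Open Scope classical_set_scope.
Local Open Scope ring_scope.

(* Random n x 1 vectors are represented componentwise: a : 'I_n -> T -> R,
   component i is the real random variable (a i). *)
Section DT.
Context {d : measure_display} {T : measurableType d} {R : realType}.
Variable (P : probability T R) (n : nat).

Definition Ex (X : T -> R) : R := fine ('E_P[X])%E.

Definition dotE (a b : 'I_n -> T -> R) : R :=
  \sum_(i < n) Ex (fun w => a i w * b i w).

(* cov(a,b) = E[(a - E a)'(b - E b)] (Hilbert-space covariance) *)
Definition vcov (a b : 'I_n -> T -> R) : R :=
  \sum_(i < n) (Ex (fun w => a i w * b i w) - Ex (a i) * Ex (b i)).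
Definition vvar (a : 'I_n -> T -> R) : R := vcov a a.
Definition vcorr (a b : 'I_n -> T -> R) : R :=
  vcov a b / Num.sqrt (vvar a * vvar b).

Definition dotw (a b : 'I_n -> T -> R) (w : T) : R := \sum_(i < n) a i w * b i w.

(* r = (I - P_x) y, P_x = x (x'x)^-1 x' (realisation-wise) *)
Definition resid (x y : 'I_n -> T -> R) : 'I_n -> T -> R :=
  fun i w => y i w - (dotw x y w / dotw x x w) * x i w.

Definition ksign (x u : 'I_n -> T -> R) : R := - Num.sg (vcov x u).

Definition synth (x y u : 'I_n -> T -> R) (delta : R) : 'I_n -> T -> R :=
  fun i w => x i w + ksign x u * delta * resid x y i w.

Definition gam (x y u : 'I_n -> T -> R) (delta : R) : R :=
  vcov x (synth x y u delta) / vvar (synth x y u delta).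
Definition fs_err (x y u : 'I_n -> T -> R) (delta : R) : 'I_n -> T -> R :=
  fun i w => x i w - gam x y u delta * synth x y u delta i w.

Definition DTmoment (x y u z0 : 'I_n -> T -> R) (sigma2 : R) (delta : R)
  : 'rV[R]_n :=
  \row_(i < n) Ex (fun w => (fs_err x y u delta i w ^+ 2 - sigma2) * z0 i w).

Definition tupv (z : 'I_n -> T -> R) : T -> n.-tuple R :=
  fun w => [tuple z i w | i < n].

(* E(V | Z) = c (c a constant): V integrable and, for every measurable set
   B of R^n, E[V 1_{Z in B}] = c P(Z in B) -- the defining property of the
   conditional expectation, the constant c being sigma(Z)-measurable. *)
Definition cond_mean_const (V : T -> R) (Z : T -> n.-tuple R) (c : R) : Prop :=
  P.-integrable setT (EFin \o V) /\
  forall B : set (n.-tuple R), measurable B ->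
    (\int[P]_(w in Z @^-1` B) (V w)%:E = c%:E * P (Z @^-1` B))%E.

Definition indep_family {d'} {V : measurableType d'} (X : 'I_n -> T -> V) : Prop :=
  forall B : 'I_n -> set V, (forall i, measurable (B i)) ->
    P (\bigcap_(i in setT) (X i @^-1` B i)) = (\prod_(i < n) P (X i @^-1` B i))%E.

Definition ident_distr {d'} {V : measurableType d'} (X : 'I_n -> T -> V) : Prop :=
  forall (i j : 'I_n) (B : set V), measurable B ->
    P (X i @^-1` B) = P (X j @^-1` B).

End DT.

(* Main.v *)
Require Import Defs.
From HB Require Import structures.
From mathcomp Require Import all_boot all_order all_algebra.
From mathcomp Require Import all_classical all_reals all_analysis.
From mathcomp Require Import measurable_realfun ring.
Import Order.TTheory GRing.Theory Num.Theory.
Import numFieldNormedType.Exports.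
Local Open Scope classical_set_scope.
Local Open Scope ring_scope.
Set Implicit Arguments. Unset Strict Implicit. Unset Printing Implicit Defensive.
Import HBNNSimple.

(** At [delta0] the instrument is [z0] itself, so the i-th entry of the DT
   moment is E[(e_i^2 - sigma^2) z0_i].  Since E(e_i^2 | z0) = sigma^2, the
   tower property applied to the coordinate function t |-> t_i makes it
   vanish; here the tower property is derived from the defining identity
   E[V 1_{z0 in B}] = c P(z0 in B) by splitting V - c and t_i into positive
   and negative parts.  A zero of a curve with nonzero derivative is
   isolated, which yields the neighbourhood, shrunk to lie in (0, deltabar). *)

Lemma ge0_integralD_EFin d (T : measurableType d) (R : realType)
    (mu : {measure set T -> \bar R}) (f g : T -> R) :
  measurable_fun setT f -> measurable_fun setT g ->
  (forall x, 0 <= f x) -> (forall x, 0 <= g x) ->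
  (\int[mu]_x ((f \+ g) x)%:E = \int[mu]_x (f x)%:E + \int[mu]_x (g x)%:E)%E.
Proof.
move=> mf mg f_ge0 g_ge0; under eq_integral do rewrite EFinD.
by rewrite ge0_integralD// => [x _||x _|]; rewrite ?lee_fin//; exact/measurable_EFinP.
Qed.

Section integral_weighted_comp.
Local Open Scope ereal_scope.
Context d (T : measurableType d) (R : realType) (mu : {measure set T -> \bar R}).
Context d' (Y : measurableType d') (Z : T -> Y) (mZ : measurable_fun setT Z).

Section weight.
Variable W : T -> R.
Hypotheses (mW : measurable_fun setT W) (W_ge0 : forall x, (0 <= W x)%R).

Lemma integral_mul_indic_comp (A : set Y) (k : R) : measurable A -> (0 <= k)%R ->
  \int[mu]_x (W x * (k * \1_A (Z x)))%:E =
  k%:E * \int[mu]_(x in Z @^-1` A) (W x)%:E.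
Proof.
move=> mA k0; under eq_integral do rewrite mulrCA EFinM.
rewrite ge0_integralZl//; last 2 first.
- apply/measurable_EFinP; apply: measurable_funM => //.
  by apply: measurableT_comp => //; exact/measurable_indicP.
- by move=> x _; rewrite lee_fin mulr_ge0.
congr (_ * _); rewrite [RHS]integral_mkcond; apply: eq_integral => x _.
rewrite /patch indicE (_ : (x \in Z @^-1` A) = (Z x \in A)); last first.
  by apply/idP/idP => /set_mem ?; apply/mem_set.
by case: (Z x \in A); rewrite ?mulr1 ?mulr0.
Qed.

Lemma integral_mul_nnsfun_comp (h : {nnsfun Y >-> R}) :
  \int[mu]_x (W x * h (Z x))%:E =
  \sum_(k \in range h) k%:E * \int[mu]_(x in Z @^-1` (h @^-1` [set k])) (W x)%:E.
Proof.
have mhk k : measurable_fun setT (fun x => W x * (k * \1_(h @^-1` [set k]) (Z x)))%R.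
  apply: measurable_funM => //; apply: measurable_funM => //.
  exact: measurableT_comp.
transitivity (\sum_(k \in range h)
    \int[mu]_x (W x * (k * \1_(h @^-1` [set k]) (Z x)))%:E).
  rewrite -ge0_integral_fsum//.
  - apply: eq_integral => x _; rewrite fsumEFin//; congr EFin.
    by rewrite [in LHS]fimfunE mulr_fsumr.
  - by move=> k; apply/measurable_EFinP.
  - move=> k x _; rewrite lee_fin mulr_ge0//.
    by have := nnfun_muleindic_ge0 h k (Z x); rewrite -EFinM lee_fin.
apply: eq_fsbigr => _ /set_mem[y _ <-].
exact: integral_mul_indic_comp.
Qed.

End weight.

(* Approximate [g] from below by simple functions: for those the claim is a
   finite combination of the hypothesis, and monotone convergence passes to
   the limit. *)
Lemma eq_integral_mul_comp (W1 W2 : T -> R) (g : Y -> R) :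
  measurable_fun setT W1 -> measurable_fun setT W2 ->
  (forall x, 0 <= W1 x)%R -> (forall x, 0 <= W2 x)%R ->
  measurable_fun setT g -> (forall y, 0 <= g y)%R ->
  (forall B, measurable B ->
     \int[mu]_(x in Z @^-1` B) (W1 x)%:E = \int[mu]_(x in Z @^-1` B) (W2 x)%:E) ->
  \int[mu]_x (W1 x * g (Z x))%:E = \int[mu]_x (W2 x * g (Z x))%:E.
Proof.
move=> mW1 mW2 W1_ge0 W2_ge0 mg g_ge0 W12.
have meg : measurable_fun setT (EFin \o g) by exact/measurable_EFinP.
pose h := nnsfun_approx measurableT meg.
have integral_lim (W : T -> R) : measurable_fun setT W -> (forall x, 0 <= W x)%R ->
    \int[mu]_x (W x * g (Z x))%:E =
    limn (fun n => \int[mu]_x (W x * h n (Z x))%:E).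
  move=> mW W_ge0; rewrite -monotone_convergence//; last 3 first.
  - move=> n; apply/measurable_EFinP; apply: measurable_funM => //.
    exact: measurableT_comp.
  - by move=> n x _; rewrite lee_fin mulr_ge0.
  - move=> x _ a b ab; rewrite lee_fin ler_wpM2l//.
    exact/lefP/nd_nnsfun_approx.
  apply: eq_integral => x _; apply/esym/cvg_lim => //.
  under eq_fun do rewrite EFinM; rewrite EFinM.
  by apply: cvgeMl => //; apply: cvg_nnsfun_approx => // y _; rewrite lee_fin.
rewrite (integral_lim W1)// (integral_lim W2)//; congr (lim (_ @ \oo)).
apply/funext => n; rewrite !integral_mul_nnsfun_comp//.
by apply: eq_fsbigr => k _; rewrite W12.
Qed.

End integral_weighted_comp.

Section funrposM.
Context {T : Type} {R : realFieldType}.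
Implicit Types f g : T -> R.

Lemma funrposM f g : (f \* g)^\+ = f^\+ \* g^\+ \+ f^\- \* g^\-.
Proof.
apply/funext => x; rewrite /funrpos /funrneg /= !maxr_absE !subr0 !addr0.
by rewrite !normrN normrM; field.
Qed.

Lemma funrnegM f g : (f \* g)^\- = f^\+ \* g^\- \+ f^\- \* g^\+.
Proof.
apply/funext => x; rewrite /funrpos /funrneg /= !maxr_absE !subr0 !addr0.
by rewrite !normrN normrM; field.
Qed.

End funrposM.

Section cond_mean_const.
Local Open Scope ereal_scope.
Context d (T : measurableType d) (R : realType) (P : probability T R) (n : nat).
Variables (V : T -> R) (Z : T -> n.-tuple R) (c : R).
Hypotheses (mZ : measurable_fun setT Z) (VZc : cond_mean_const P V Z c).

Let W : T -> R := fun w => (V w - c)%R.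

Let mW : measurable_fun setT W.
Proof.
have [/integrableP[/measurable_EFinP mV _] _] := VZc.
exact: measurable_funB.
Qed.

Lemma cond_mean_const_preimage B : measurable B ->
  \int[P]_(x in Z @^-1` B) (W^\+ x)%:E = \int[P]_(x in Z @^-1` B) (W^\- x)%:E.
Proof.
move=> mB; have [intV VB] := VZc.
have mZB : measurable (Z @^-1` B) by rewrite -[_ @^-1` _]setTI; exact: mZ.
have intW : P.-integrable (Z @^-1` B) (EFin \o W).
  apply: integrableS (_ : P.-integrable setT _) => //.
  rewrite (_ : EFin \o W = (EFin \o V) \- (EFin \o cst c)); last first.
    by apply/funext => x; rewrite /= EFinB.
  exact/integrableB/finite_measure_integrable_cst.
have intW0 : \int[P]_(x in Z @^-1` B) (EFin \o W) x = 0.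
  under eq_integral do rewrite /= EFinB.
  rewrite integralB_EFin//; last 2 first.
  - exact: integrableS intV.
  - exact: finite_measure_integrable_cst.
  by rewrite VB// integral_cst// subee// fin_numM// fin_num_measure.
have Wneg_fin := integrable_neg_fin_num mZB intW.
rewrite funerneg in Wneg_fin.
rewrite integralE funerpos funerneg in intW0.
by rewrite -[LHS](subeK _ Wneg_fin) intW0 add0e.
Qed.

Lemma cond_mean_const_tower (h : n.-tuple R -> R) :
  measurable_fun setT h -> (forall t, 0 <= h t)%R ->
  \int[P]_x (W^\+ x * h (Z x))%:E = \int[P]_x (W^\- x * h (Z x))%:E.
Proof.
move=> mh h_ge0; apply: eq_integral_mul_comp => //.
- exact: measurable_funrpos.
- exact: measurable_funrneg.
- exact: cond_mean_const_preimage.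
Qed.

Lemma cond_mean_const_orth (g : n.-tuple R -> R) : measurable_fun setT g ->
  P.-integrable setT (EFin \o (fun w => (V w - c) * g (Z w))%R) ->
  Ex P (fun w => (V w - c) * g (Z w))%R = 0%R.
Proof.
move=> mg intF.
have mgZ : measurable_fun setT (g \o Z) by exact: measurableT_comp.
set F := (W \* (g \o Z))%R.
have Fpos : \int[P]_x (EFin \o F)^\+ x =
    \int[P]_x (W^\+ x * g^\+ (Z x))%:E + \int[P]_x (W^\- x * g^\- (Z x))%:E.
  rewrite funerpos funrposM ge0_integralD_EFin// => [||x|x]; rewrite ?mulr_ge0//.
  - exact: measurable_funM (measurable_funrpos mW) (measurable_funrpos mgZ).
  - exact: measurable_funM (measurable_funrneg mW) (measurable_funrneg mgZ).
have Fneg : \int[P]_x (EFin \o F)^\- x =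
    \int[P]_x (W^\+ x * g^\- (Z x))%:E + \int[P]_x (W^\- x * g^\+ (Z x))%:E.
  rewrite funerneg funrnegM ge0_integralD_EFin// => [||x|x]; rewrite ?mulr_ge0//.
  - exact: measurable_funM (measurable_funrpos mW) (measurable_funrneg mgZ).
  - exact: measurable_funM (measurable_funrneg mW) (measurable_funrpos mgZ).
have := integrable_neg_fin_num measurableT intF; rewrite Fneg => Fneg_fin.
rewrite /Ex unlock integralE Fpos Fneg.
rewrite (cond_mean_const_tower (measurable_funrpos mg) (funrpos_ge0 g)).
rewrite -(cond_mean_const_tower (measurable_funrneg mg) (funrneg_ge0 g)).
by rewrite [X in X - _]addeC subee.
Qed.

End cond_mean_const.

Section isolated_zero.
Context {R : realType} {V : normedModType R}.

(* Near [a], [f t - f a] is [(t - a)] times a vector close to [f'(a) <> 0]. *)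
Lemma derive1_neq0_isolated (f : R -> V) (a : R) :
  derivable f a 1 -> derive1 f a != 0 -> \forall t \near a, f t = f a -> t = a.
Proof.
move=> df f'a_neq0.
have : (fun h => h^-1 *: (f (h + a) - f a)) @ 0^' --> derive1 f a.
  rewrite derive1E (_ : (fun h => _) = fun h => h^-1 *: ((f \o shift a) (h *: 1) - f a)).
    exact: df.
  by apply/funext => h /=; rewrite /shift [h%:A]mulr1.
have f'a_gt0 : 0 < `|derive1 f a| by rewrite normr_gt0.
move/cvgrPdist_lt/(_ _ f'a_gt0); rewrite /dnbhs /within /= => /nbhs_ballP[e /= e_gt0 near_a].
apply/nbhs_ballP; exists e => // t /= ate fta; apply/eqP; rewrite -subr_eq0.
apply/negPn/negP => ta_neq0.
have := near_a (t - a); rewrite /ball /= sub0r normrN distrC => /(_ ate ta_neq0).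
by rewrite subrK fta subrr scaler0 subr0 ltxx.
Qed.

Lemma derive1_neq0_isolated_zero (f : R -> V) (a b t0 : R) :
  a < t0 < b -> f t0 = 0 -> derivable f t0 1 -> derive1 f t0 != 0 ->
  exists N : set R, nbhs t0 N /\ (forall t, N t -> a < t < b) /\
    forall t, N t -> (f t = 0 <-> t = t0).
Proof.
move=> t0ab ft0 df f't0.
exists ([set t | f t = f t0 -> t = t0] `&` `]a, b[); split; [|split].
- apply: filterI; first exact: derive1_neq0_isolated.
  by apply: open_nbhs_nbhs; split; [exact: itv_open|rewrite /= in_itv].
- by move=> t [_ /=]; rewrite in_itv.
- by move=> t [/= isol _]; split=> [ft|->//]; apply: isol; rewrite ft ft0.
Qed.

End isolated_zero.

Section DT_moment.
Context d (T : measurableType d) (R : realType) (P : probability T R) (n : nat).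

Lemma measurable_tupv (z : 'I_n -> T -> R) :
  (forall i, measurable_fun setT (z i)) -> measurable_fun setT (tupv z).
Proof.
move=> mz; apply/measurable_fun_tnthP => i.
by rewrite (_ : _ \o _ = z i)//; apply/funext => w /=; rewrite tnth_mktuple.
Qed.

Lemma DTmoment_eq0 (x y u z : 'I_n -> T -> R) (s2 delta : R) :
  (forall i, measurable_fun setT (z i)) ->
  (forall i, cond_mean_const P (fun w => fs_err P x y u delta i w ^+ 2) (tupv z) s2) ->
  (forall i, P.-integrable setT
     (EFin \o (fun w => (fs_err P x y u delta i w ^+ 2 - s2) * z i w))) ->
  DTmoment P x y u z s2 delta = 0.
Proof.
move=> mz homo intM; apply/rowP => i; rewrite !mxE.
have tupvE w : z i w = tnth (tupv z w) i by rewrite tnth_mktuple.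
under eq_fun do rewrite tupvE.
apply: (cond_mean_const_orth (measurable_tupv mz) (homo i) (measurable_tnth i)).
under eq_fun do rewrite -tupvE.
exact: intM.
Qed.

End DT_moment.

Unset Implicit Arguments.
Set Strict Implicit.
Theorem theorem1 (d : measure_display) (T : measurableType d) (R : realType)
  (P : probability T R) (n : nat)
  (x y u z0 : 'I_n -> T -> R) (beta sigma deltabar c delta0 : R)
  (* random vectors *)
  (mx : forall i, measurable_fun setT (x i))
  (my : forall i, measurable_fun setT (y i))
  (mz : forall i, measurable_fun setT (z0 i))
  (* structural model and endogeneity *)
  (Hmodel : forall i w, y i w = beta * x i w + u i w)
  (Hendo : vcov P x u != 0)
  (* A1 (coplanarity; x, r, s in W(x,y) holds by construction) *)
  (HA1orth : dotE P (resid x y) x = 0)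
  (HA1iid : indep_family P (fun i w => (y i w, x i w, resid x y i w)) /\
            ident_distr P (fun i w => (y i w, x i w, resid x y i w)))
  (* A2 *)
  (Hdb : 0 < deltabar) (Hc : 0 < c)
  (Hcorr : forall delta, 0 < delta < deltabar ->
             c <= vcorr P (synth P x y u delta) x)
  (* A3 *)
  (HA3 : forall i, P.-integrable setT (EFin \o (fun w => x i w * y i w)) /\
                   P.-integrable setT (EFin \o (fun w => x i w * x i w)))
  (HA3pos : 0 < dotE P x x)
  (* the valid coplanar instrument z0 = s(delta0), delta0 in (0, deltabar) *)
  (Hd0 : 0 < delta0 < deltabar)
  (Hz0 : forall i w, z0 i w = synth P x y u delta0 i w)
  (Hu : forall i, cond_mean_const P (u i) (tupv z0) 0)
  (* A4, homoscedastic part, for the first-stage error e = e(delta0) *)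
  (HA4ind : indep_family P (fs_err P x y u delta0))
  (HA4hom : forall i, cond_mean_const P (fun w => fs_err P x y u delta0 i w ^+ 2)
                        (tupv z0) (sigma ^+ 2))
  (Hee : forall i j, cond_mean_const P
           (fun w => fs_err P x y u delta0 i w * fs_err P x y u delta0 j w)
           (tupv z0) (if i == j then sigma ^+ 2 else 0))
  (* the DT moment vector exists *)
  (HMint : forall delta, 0 < delta < deltabar -> forall i,
     P.-integrable setT
       (EFin \o (fun w => (fs_err P x y u delta i w ^+ 2 - sigma ^+ 2) * z0 i w)))
  :
  let M := DTmoment P x y u z0 (sigma ^+ 2) in
  M delta0 = 0 /\
  ((forall delta, 0 < delta < deltabar -> derivable M delta 1) ->
   (forall delta, 0 < delta < deltabar ->
     {for delta, continuous (fun t => derive1 M t)}) ->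
   derive1 M delta0 != 0 ->
   exists N : set R, nbhs delta0 N /\ (forall t, N t -> 0 < t < deltabar) /\
     forall delta, N delta -> (M delta = 0 <-> delta = delta0)).
Proof.
move=> M; have M0 : M delta0 = 0 := DTmoment_eq0 mz HA4hom (HMint _ Hd0).
split=> // dM _ dM0.
exact: derive1_neq0_isolated_zero Hd0 M0 (dM _ Hd0) dM0.
Qed.
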